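(* Let $\Delta$ be a finite simplicial complex on the vertex set $V=\{x_1,\dots,x_n\}$, and let $\chi$ be any $s$-colouring of $\Delta$, given by the partition $V = V_1\cup\dots\cup V_s$. Then the simplicial complex $\Delta_\chi$ is balanced and vertex decomposable.
   Context: A finite simplicial complex $\Delta$ on a finite vertex set $V$ is a collection of subsets of $V$ closed under taking subsets, and containing $\emptyset$; its elements are called faces and its inclusion-maximal faces are called facets. A face $\sigma$ has dimension $|\sigma|-1$; $\dim\Delta$ is the maximum dimension of a facet; $\Delta$ is pure if all facets have the same dimension. A simplex is a complex with exactly one facet (including $\{\emptyset\}$). An $s$-colouring of $\Delta$ is a partition $V=V_1\cup\dots\cup V_s$ into pairwise disjoint sets (some $V_j$ may be empty) such that $|F\cap V_j|\le 1$ for every facet $F$ of $\Delta$ and every $1\le j\le s$. If an $s$-colouring exists, $\Delta$ is $s$-colourable. A complex of dimension $d-1$ is balanced if it is $d$-colourable. Given an $s$-colouring $\chi$ of $\Delta$, $V=V_1\cup\dots\cup V_s$, let $y_1,\dots,y_s$ be new vertices. $\Delta_\chi$ is the simplicial complex on $\{x_1,\dots,x_n,y_1,\dots,y_s\}$ whose faces are the sets $\sigma\cup\tau$ with $\sigma\in\Delta$, $\tau\subseteq\{y_1,\dots,y_s\}$, and $\sigma\cap V_j=\emptyset$ for all $y_j\in\tau$. For a vertex $v$ with $\{v\}\in\Delta$: deletion $\Delta\setminus v=\{\tau\in\Delta : v\notin\tau\}$; link ${\rm link}_\Delta(v)=\{\tau\in\Delta : v\notin\tau,\ \tau\cup\{v\}\in\Delta\}$.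 A pure simplicial complex $\Delta$ is vertex decomposable (defined recursively) if either $\Delta$ is a simplex, or there is a vertex $v$ of $\Delta$ such that $\Delta\setminus v$ and ${\rm link}_\Delta(v)$ are both (pure and) vertex decomposable. *)

(* Defs.v *)
From mathcomp Require Import all_boot all_order all_algebra.
Set Implicit Arguments.
Unset Strict Implicit.
Unset Printing Implicit Defensive.
Import Order.TTheory GRing.Theory Num.Theory.
Local Open Scope ring_scope.

(* The finite type T is the ambient vertex set V; an element v of T need not
   satisfy [set v] \in D. *)
Definition simplicial_complex (T : finType) (D : {set {set T}}) : Prop :=
  set0 \in D /\
  (forall s t : {set T}, s \in D -> t \subset s -> t \in D).

Definition facets (T : finType) (D : {set {set T}}) : {set {set T}} :=
  [set F in D | [forall G in D, (F \subset G) ==> (F == G)]].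

Definition face_dim (T : finType) (s : {set T}) : int := #|s|%:Z - 1.

(* The default value -1 is the least possible dimension of a face, so this is
   the maximum over the facets for every simplicial complex. *)
Definition complex_dim (T : finType) (D : {set {set T}}) : int :=
  \big[Num.max/-1]_(F in facets D) face_dim F.

Definition pure (T : finType) (D : {set {set T}}) : Prop :=
  forall F G : {set T}, F \in facets D -> G \in facets D ->
    face_dim F = face_dim G.

Definition simplex (T : finType) (D : {set {set T}}) : Prop :=
  simplicial_complex D /\ #|facets D| = 1%N.

(* The classes are indexed by 'I_s rather than collected in a {set {set T}},
   since several of them may be empty. *)
Definition colouring (T : finType) (D : {set {set T}}) (s : nat)
    (P : 'I_s -> {set T}) : Prop :=
  [/\ \bigcup_(j < s) P j = [set: T],
      forall i j : 'I_s, i != j -> [disjoint P i & P j] &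
      forall (F : {set T}) (j : 'I_s), F \in facets D ->
        (#|F :&: P j| <= 1)%N].

Definition colourable (T : finType) (D : {set {set T}}) (s : nat) : Prop :=
  exists P : 'I_s -> {set T}, colouring D P.

Definition balanced (T : finType) (D : {set {set T}}) : Prop :=
  exists2 d : nat, complex_dim D = d%:Z - 1 & colourable D d.

Definition deletion (T : finType) (D : {set {set T}}) (v : T) :
    {set {set T}} :=
  [set t in D | v \notin t].

Definition link (T : finType) (D : {set {set T}}) (v : T) : {set {set T}} :=
  [set t in D | (v \notin t) && (v |: t \in D)].

Inductive vertex_decomposable (T : finType) (D : {set {set T}}) : Prop :=
| VD_simplex of simplicial_complex D & pure D & simplex D
| VD_vertex (v : T) of simplicial_complex D & pure D & [set v] \in D &
    vertex_decomposable (deletion D v) & vertex_decomposable (link D v).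

(* In the vertex set T + 'I_s of Delta_chi, inl x is the old vertex x and inr j
   is the new vertex y_j. *)
Definition Delta_chi (T : finType) (D : {set {set T}}) (s : nat)
    (P : 'I_s -> {set T}) : {set {set T + 'I_s}} :=
  [set inl @: sigma :|: inr @: tau
     | sigma : {set T} in D, tau : {set 'I_s} in [set: {set 'I_s}]
     & [forall j in tau, sigma :&: P j == set0]].

(* Main.v *)
Require Import Defs.
From mathcomp Require Import all_boot all_order all_algebra.

(** Let [k] colour [x] by its class and [y_j] by [j].  A set of old and new
    vertices is a face of [Delta_chi] iff its old part is a face of [Delta] and
    [k] is injective on it.  A face missing the colour [j] can be enlarged by
    [y_j], so the facets are the faces on which [k] is a bijection onto the set
    of colours; this gives purity and balancedness.  For a vertex [x] of
    [Delta], the deletion and the link of [x] are complexes of the same kind,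
    for the deletion and the link of [x] in [Delta], the link losing the colour
    of [x]; when no such [x] is left the complex is the simplex on the new
    vertices. *)

Import Order.TTheory GRing.Theory Num.Theory.

(** * Images, facets, deletions and links *)

(** Equality of cardinals is injectivity in boolean form. If [f a] repeats a value, the image of
    [a |: S] has at most [#|S|] elements, one too few. *)
Lemma card_imsetU1_inj {A B : finType} (f : A -> B) {a : A} {S : {set A}} :
  a \notin S ->
  (#|f @: (a |: S)| == #|a |: S|) =
  (f a \notin f @: S) && (#|f @: S| == #|S|).
Proof.
move=> aS; rewrite imsetU1 !cardsU1 aS.
case: (f a \notin _) => /=; first by rewrite !add1n eqSS.
by rewrite add0n add1n ltn_eqF // ltnS leq_imset_card.
Qed.

Lemma facetP {T : finType} {D : {set {set T}}} {F : {set T}} :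
  reflect (F \in D /\ forall G : {set T}, G \in D -> F \subset G -> F = G)
          (F \in facets D).
Proof.
rewrite inE; apply: (iffP andP) => -[FD Fmax]; split=> //.
  by move=> G GD FG; apply/eqP; move/forall_inP/(_ G GD)/implyP: Fmax; apply.
by apply/forall_inP => G GD; apply/implyP => FG; apply/eqP/Fmax.
Qed.

Lemma face_sub_facet {T : finType} {D : {set {set T}}} {S : {set T}} :
  S \in D -> exists2 F, F \in facets D & S \subset F.
Proof.
move=> SD; have [F /maxsetP [FD Fmax] SF] := @maxset_exists _ (mem D) S SD.
by exists F => //; apply/facetP; split=> // G GD FG; rewrite (Fmax G).
Qed.

Lemma simplicial_complex_deletion {T : finType} {D : {set {set T}}} (v : T) :
  simplicial_complex D -> simplicial_complex (deletion D v).
Proof.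
move=> [D0 Dsub]; split=> [|S R]; first by rewrite inE D0 inE.
rewrite !inE => /andP [SD vS] RS; rewrite (Dsub S R) //=.
by apply: contra vS; apply/subsetP.
Qed.

Lemma simplicial_complex_link {T : finType} {D : {set {set T}}} (v : T) :
  simplicial_complex D -> [set v] \in D -> simplicial_complex (link D v).
Proof.
move=> [D0 Dsub] vD; split=> [|S R]; first by rewrite inE D0 inE setU0.
rewrite !inE => /and3P [SD vS vSD] RS; rewrite (Dsub S R) //=.
apply/andP; split.
  by apply: contra vS; apply/subsetP.
by apply: (Dsub _ _ vSD); apply: setUS.
Qed.

(** * Rainbow complexes *)

Definition sum_colour {T I : Type} (c : T -> I) (u : T + I) : I :=
  match u with inl x => c x | inr j => j end.

(** The set [J] of admissible colours is a parameter because passing to a link removes a colour. *)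
Definition rainbow_complex {T I : finType} (c : T -> I) (D : {set {set T}})
    (J : {set I}) : {set {set T + I}} :=
  [set r : {set T + I} |
    [&& inl @^-1: r \in D, #|sum_colour c @: r| == #|r| &
        sum_colour c @: r \subset J]].

Section RainbowComplex.
Local Set Implicit Arguments.
Variables (T I : finType) (c : T -> I).
Implicit Types (D : {set {set T}}) (J : {set I}) (r : {set T + I}).

Lemma rainbow_complex_simplicial D J :
  simplicial_complex D -> simplicial_complex (rainbow_complex c D J).
Proof.
move=> [D0 Dsub]; split=> [|r t].
  by rewrite inE preimset0 D0 imset0 !cards0 eqxx sub0set.
rewrite !inE => /and3P [rD /imset_injP rI rJ] tr; apply/and3P; split.
- by apply: (Dsub _ _ rD); apply: preimsetS.
- by apply/imset_injP; apply: sub_in2 rI; apply/subsetP.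
- by apply: subset_trans rJ; apply: imsetS.
Qed.

Lemma new_vertices_face D J :
  simplicial_complex D -> inr @: J \in rainbow_complex c D J.
Proof.
move=> [D0 _]; rewrite inE.
have -> : inl @^-1: (@inr T I @: J) = set0.
  by apply/setP => x; rewrite !inE; apply/imsetP => -[].
rewrite D0 -imset_comp (eq_imset _ (_ : _ =1 id)) // imset_id subxx andbT /=.
by rewrite card_imset // => i j [].
Qed.

Lemma rainbow_facet_colours D J r :
  r \in facets (rainbow_complex c D J) -> sum_colour c @: r = J.
Proof.
move=> /facetP [rK rmax]; move: (rK); rewrite inE => /and3P [rD rI rJ].
apply/eqP; rewrite eqEsubset rJ; apply/subsetP => j jJ.
apply/negPn/negP => jr.
have jnr : inr j \notin r by apply: contra jr => /(imset_f (sum_colour c)).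
(* Adding [inr j] leaves the old part unchanged and uses a fresh colour, so the result is again a
   face, against maximality. *)
have /rmax : inr j |: r \in rainbow_complex c D J.
  rewrite inE card_imsetU1_inj // rI jr imsetU1 subUset sub1set jJ rJ !andbT.
  rewrite (_ : inl @^-1: _ = inl @^-1: r) //.
  by apply/setP => x; rewrite !inE.
by move=> /(_ (subsetUr _ _)) rE; case/negP: jnr; rewrite rE setU11.
Qed.

Lemma rainbow_facet_card D J r :
  r \in facets (rainbow_complex c D J) -> #|r| = #|J|.
Proof.
move=> rF; rewrite -(rainbow_facet_colours rF).
by case/facetP: rF; rewrite inE => /and3P [_ /eqP ->].
Qed.

Lemma rainbow_complex_pure D J : pure (rainbow_complex c D J).
Proof.
move=> F G FF GF.
by rewrite /face_dim (rainbow_facet_card FF) (rainbow_facet_card GF).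
Qed.

Lemma rainbow_complex_dim D J :
  simplicial_complex D ->
  complex_dim (rainbow_complex c D J) = (#|J|%:Z - 1)%R.
Proof.
move=> Dsc; rewrite /complex_dim.
rewrite (eq_bigr (fun=> #|J|%:Z - 1)%R); last first.
  by move=> F FF; rewrite /face_dim (rainbow_facet_card FF).
(* Some facet must exist for the maximum to reach [#|J| - 1]; the default [-1] never exceeds this
   value. *)
have [F FF _] := face_sub_facet (new_vertices_face J Dsc).
apply/eqP; rewrite eq_le; apply/andP; split.
  by apply: bigmax_le => //; rewrite lerBrDr addNr.
exact: (le_bigmax_cond _ (fun=> #|J|%:Z - 1)%R FF).
Qed.

Lemma rainbow_complex_balanced D J :
  simplicial_complex D -> J = [set: I] -> balanced (rainbow_complex c D J).
Proof.
move=> Dsc JT; exists #|I|.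
  by rewrite rainbow_complex_dim // JT cardsT.
(* The classes are the fibres of [sum_colour c], reindexed by [enum_val]. *)
exists (fun i => [set u | sum_colour c u == enum_val i]); split.
- apply/setP => u; rewrite inE; apply/bigcupP.
  by exists (enum_rank (sum_colour c u)); rewrite // inE enum_rankK.
- move=> i j ij; rewrite -setI_eq0; apply/eqP/setP => u; rewrite !inE.
  apply/negP => /andP [/eqP -> /eqP /enum_val_inj ijE].
  by rewrite ijE eqxx in ij.
- move=> F j /facetP []; rewrite inE => /and3P [_ /imset_injP FI _] _.
  apply/card_le1_eqP => u v; rewrite !inE.
  by move=> /andP [uF /eqP uj] /andP [vF /eqP vj]; apply: FI => //; rewrite uj.
Qed.

Lemma rainbow_complex_deletion D J (x : T) :
  deletion (rainbow_complex c D J) (inl x) =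
  rainbow_complex c (deletion D x) J.
Proof.
by apply/setP => r; rewrite !inE -!andbA; do !bool_congr.
Qed.

(** Adding [inl x] keeps the colours distinct exactly when [c x] is not yet used, that is, when the
    colours of [r] avoid [c x]. *)
Lemma rainbow_complex_link D J (x : T) :
  c x \in J ->
  link (rainbow_complex c D J) (inl x) =
  rainbow_complex c (link D x) (J :\ c x).
Proof.
move=> xJ; apply/setP => r; rewrite !inE.
have [xr|xr] := boolP (inl x \in r); first by rewrite !andbF.
rewrite card_imsetU1_inj // imsetU1 subUset sub1set xJ subsetD1 /=.
have -> : inl @^-1: (inl x |: r) = x |: inl @^-1: r.
  by apply/setP => z; rewrite !inE.
case: (_ \in D) => //=; case: (_ == _); rewrite ?andbF //=.
by case: (_ \subset J); rewrite ?andbF ?andbT //= andbC.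
Qed.

(** An old vertex in a face would be a vertex of [D] with colour in [J]. Hence every face lies in
    [inr @: J], which is the only facet. *)
Lemma rainbow_complex_simplex D J :
  simplicial_complex D ->
  (forall x, [set x] \in D -> c x \notin J) -> simplex (rainbow_complex c D J).
Proof.
move=> Dsc noV; split; first exact: rainbow_complex_simplicial.
have subnew r : r \in rainbow_complex c D J -> r \subset inr @: J.
  rewrite inE => /and3P [rD _ /subsetP rJ]; apply/subsetP => -[x|j] ur.
    have /noV/negP[] : [set x] \in D.
      by apply: Dsc.2 rD _; rewrite sub1set inE.
    exact/rJ/(imset_f (sum_colour c) ur).
  exact/imset_f/rJ/(imset_f (sum_colour c) ur).
have newK := new_vertices_face J Dsc.
apply/eqP/cards1P; exists (inr @: J); apply/setP => F.
apply/facetP/set1P => [[FK Fmax]|->]; first exact/Fmax/subnew.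
split=> // G GK JG; apply/eqP; rewrite eqEsubset JG; exact: subnew.
Qed.

(** Induction on the number of faces of [D], for all [J] at once: [[set x]] is a face of [D] but of
    neither its deletion nor its link at [x]. *)
Lemma rainbow_complex_vertex_decomposable D J :
  simplicial_complex D -> vertex_decomposable (rainbow_complex c D J).
Proof.
have [n] := ubnP #|D|; elim: n => // n IHn in D J *; rewrite ltnS => leDn Dsc.
have Ksc := rainbow_complex_simplicial J Dsc.
have Kpure := @rainbow_complex_pure D J.
have [x /andP [xD xJ]|noV] := pickP [pred x | ([set x] \in D) && (c x \in J)];
  last first.
  apply: VD_simplex => //; apply: rainbow_complex_simplex => // x xD.
  by move: (noV x); rewrite /= xD => /= ->.
have smaller (E : {set {set T}}) : E \subset D -> [set x] \notin E -> #|E| < n.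
  move=> ED xE; apply: leq_trans leDn; apply: proper_card.
  by apply/properP; split=> //; exists [set x].
apply: (@VD_vertex _ _ (inl x)) => //.
- rewrite inE imset_set1 !cards1 sub1set xJ !andbT.
  rewrite (_ : inl @^-1: _ = [set x]) //.
  by apply/setP => z; rewrite !inE.
- rewrite rainbow_complex_deletion; apply: IHn.
    apply: smaller; last by rewrite !inE eqxx andbF.
    by apply/subsetP => t; rewrite inE => /andP [].
  exact: simplicial_complex_deletion.
- rewrite rainbow_complex_link //; apply: IHn.
    apply: smaller; last by rewrite !inE eqxx andbF.
    by apply/subsetP => t; rewrite inE => /andP [].
  exact: simplicial_complex_link.
Qed.

End RainbowComplex.

(** * Identification of [Delta_chi] *)

Lemma Delta_chi_rainbow {V : finType} {D : {set {set V}}} {s : nat}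
    {P : 'I_s -> {set V}} :
  colouring D P ->
  exists c : V -> 'I_s, Delta_chi D P = rainbow_complex c D [set: 'I_s].
Proof.
move=> [Pcover Pdisj Pfacet].
have /fin_all_exists [c cP] (x : V) : exists j, x \in P j.
  have : x \in \bigcup_(j < s) P j by rewrite Pcover inE.
  by move=> /bigcupP [j _ xj]; exists j.
(* Disjointness of the classes makes the chosen colour the only one. *)
have inP x j : (x \in P j) = (c x == j).
  apply/idP/eqP => [xj|<- //]; apply/eqP/negPn/negP => /Pdisj.
  by rewrite disjoint_subset => /subsetP /(_ x (cP x)); rewrite !inE xj.
exists c; apply/setP => r; rewrite inE subsetT andbT.
apply/imset2P/andP => [[S t SD]|[rD /imset_injP rI]].
  rewrite !inE /= => /forall_inP St ->.
  have -> : inl @^-1: (inl @: S :|: inr @: t) = S.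
    apply/setP => x; rewrite !inE mem_imset; last by move=> ? ? [].
    by rewrite orbC; case: imsetP => [[]|].
  split=> //; apply/imset_injP.
  (* The condition on [t] says that no old vertex shares its colour with a new one. *)
  have Stc x j : x \in S -> j \in t -> c x <> j.
    move=> xS jt cxj; have /eqP/setP/(_ x) := St j jt.
    by rewrite !inE xS inP cxj eqxx.
  move=> u v; rewrite !inE.
  move=> /orP [] /imsetP [a aS ->] /orP [] /imsetP [b bS ->] //= ab.
  (* The colouring bounds facets only, so [S] is first placed inside a facet. *)
  - have [F FF /subsetP SF] := face_sub_facet SD.
    have /card_le1_eqP /(_ a b) := Pfacet F (c a) FF.
    by rewrite !inE !inP ab eqxx !SF // => ->.
  - by case: (Stc _ _ aS bS).
  - by case: (Stc _ _ bS aS).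
  - by rewrite ab.
(* Conversely, [r] splits into its old and new parts, and injectivity applied to a mixed pair gives
   the emptiness condition. *)
exists (inl @^-1: r) (inr @^-1: r) => //.
  rewrite !inE; apply/forall_inP => j; rewrite inE => jr.
  apply/eqP/setP => x; rewrite !inE inP; apply/negP => /andP [xr /eqP cxj].
  by have := rI (inl x) (inr j) xr jr cxj.
apply/setP => -[x|j]; rewrite !inE.
  rewrite mem_imset ?inE; last by move=> ? ? [].
  by rewrite orbC; case: imsetP => [[]|].
rewrite orbC mem_imset ?inE; last by move=> ? ? [].
by rewrite orbC; case: imsetP => [[]|].
Qed.

Theorem theorem1p1 (V : finType) (Delta : {set {set V}}) (s : nat)
    (chi : 'I_s -> {set V}) :
  simplicial_complex Delta ->
  colouring Delta chi ->
  balanced (Delta_chi Delta chi) /\ vertex_decomposable (Delta_chi Delta chi).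
Proof.
move=> Dsc /Delta_chi_rainbow [c ->]; split.
  exact: rainbow_complex_balanced.
exact: rainbow_complex_vertex_decomposable.
Qed.
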